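(* Let $m,n,r,d$ be integers with $m,n\ge2$, $d\ge1$ and $0<r<\min\{m,n\}$, and let $$\mathcal{A}=\Big\{L(\lambda)R(\lambda): L\in\mathbb{C}[\lambda]^{m\times r},\ R\in\mathbb{C}[\lambda]^{r\times n},\ \deg(L_{*i})+\deg(R_{i*})=d\ \text{for } i=1,\dots,r\Big\}.$$ Then $\mathbb{C}[\lambda]^{m\times n}_{d,r}=\overline{\mathcal{A}}$.
   Context: $\mathbb{C}[\lambda]^{m\times n}_{d,r}$ is the set of complex $m\times n$ polynomial matrices of degree at most $d$ and normal rank (rank over $\mathbb{C}(\lambda)$) at most $r$. Degree of a polynomial vector: maximum degree of entries, $\deg0=-\infty$. $L_{*i}$: $i$th column of $L$; $R_{i*}$: $i$th row of $R$. Closure is in the space $\mathbb{C}[\lambda]^{m\times n}_d$ of polynomial matrices of degree at most $d$ with the metric $\mathrm{dist}(P,Q)=(\sum_{i=0}^d\|P_i-Q_i\|_F^2)^{1/2}$, $P_i,Q_i$ the coefficients of $\lambda^i$. *)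

(* Defs.v *)
From HB Require Import structures.
From mathcomp Require Import all_boot all_order all_algebra.
From mathcomp Require Import fraction complex reals.
Set Implicit Arguments. Unset Strict Implicit. Unset Printing Implicit Defensive.
Import Order.TTheory GRing.Theory Num.Theory.
Local Open Scope ring_scope.

Section Defs.
Variable C : numClosedFieldType.

Definition mxdeg_le (d : nat) {m n} (P : 'M[{poly C}]_(m, n)) : Prop :=
  forall i j, (size (P i j) <= d.+1)%N.

Definition normal_rank {m n} (P : 'M[{poly C}]_(m, n)) : nat :=
  \rank (map_mx (@FracField.tofrac {poly C}) P).

(* Degree of a polynomial vector (matrix): max degree of entries; None = -oo. *)
Definition vdeg {a b} (v : 'M[{poly C}]_(a, b)) : option nat :=
  if v == 0 then None else Some (\max_(i < a) \max_(j < b) (size (v i j)).-1)%N.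

(* deg u + deg v = d, with -oo + x = -oo <> d. *)
Definition deg_sum_eq (u v : option nat) (d : nat) : Prop :=
  match u, v with Some x, Some y => (x + y)%N = d | _, _ => False end.

Definition setA (m n r d : nat) (P : 'M[{poly C}]_(m, n)) : Prop :=
  exists (L : 'M[{poly C}]_(m, r)) (Rm : 'M[{poly C}]_(r, n)),
    P = L *m Rm /\ forall i : 'I_r, deg_sum_eq (vdeg (col i L)) (vdeg (row i Rm)) d.

Definition pdist (d : nat) {m n} (P Q : 'M[{poly C}]_(m, n)) : C :=
  sqrtC (\sum_(k < d.+1) \sum_(i < m) \sum_(j < n) `|(P i j)`_k - (Q i j)`_k| ^+ 2).

Definition closure_d (d : nat) {m n} (S : 'M[{poly C}]_(m, n) -> Prop)
    (P : 'M[{poly C}]_(m, n)) : Prop :=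
  mxdeg_le d P /\
  forall eps : C, 0 < eps -> exists Q, S Q /\ mxdeg_le d Q /\ pdist d P Q < eps.
End Defs.

(* Main.v *)
Require Import Defs.
From HB Require Import structures.
From mathcomp Require Import all_boot all_order all_algebra.
From mathcomp Require Import fraction complex boolp reals.
Import Order.TTheory GRing.Theory Num.Theory.
Local Open Scope ring_scope.

(* Density: among the polynomial bases of the row space of [P] over the field of
   fractions, take one, [B], whose total degree is minimal.  Minimality forces [B(a)] to have full row rank at every point [a], so
   that [P = L B] with [L] polynomial, and forces the leading row coefficients to be
   independent, so that no cancellation happens and
   [deg L_{*i} + deg B_{i*} <= d].  Zero columns of [L] may be paired with arbitrary
   constant rows; adding a small multiple of [X^(d - deg B_{i*})] to one entry of
   each column of [L] then makes every degree sum equal to [d].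

   Closedness: if [P] had normal rank [k > r], then [X P Y = q I_k] for polynomial
   matrices [X, Y] and some [q <> 0]; at a point where [q] does not vanish, this is
   incompatible with [P] being a limit of products through [r] dimensions. *)

Local Notation tofracmx := (map_mx (@FracField.tofrac _)).

(** * Clearing denominators and linear algebra preliminaries *)

Lemma fraction_quotient {D : idomainType} (x : {fraction D}) :
  exists2 nd : D * D, nd.2 != 0 & FracField.tofrac nd.2 * x = FracField.tofrac nd.1.
Proof.
elim/quotW: x => x; exists (\n_x, \d_x) => /=; first exact: denom_ratioP.
rewrite [LHS]piE; unlock FracField.tofrac; apply/eqmodP.
rewrite /= FracField.equivfE /= /FracField.mulf /=.
by rewrite !numden_Ratio ?mulf_neq0 ?oner_eq0 ?denom_ratioP // mulr1 ?mul1r.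
Qed.

Lemma common_denominator {D : idomainType} {m n} (X : 'M[{fraction D}]_(m, n)) :
  exists q (L : 'M[D]_(m, n)), q != 0 /\ FracField.tofrac q *: X = tofracmx L.
Proof.
have [nd nd0 ndE] := fin_all_exists2 (fun k : 'I_m * 'I_n => fraction_quotient (X k.1 k.2)).
exists (\prod_k (nd k).2).
exists (\matrix_(i, j) ((nd (i, j)).1 * \prod_(k | k != (i, j)) (nd k).2)); split.
  by apply/prodf_neq0 => k _; exact: nd0.
apply/matrixP => i j; rewrite !mxE (bigD1 (i, j)) //= !rmorphM /= mulrAC.
by rewrite -(ndE (i, j)).
Qed.

Lemma tofracmx_inj {D : idomainType} {m n} :
  injective (fun A : 'M[D]_(m, n) => tofracmx A).
Proof.
move=> A B /matrixP AB; apply/matrixP => i j.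
by have := AB i j; rewrite !mxE => /eqP; rewrite tofrac_eq => /eqP.
Qed.

Lemma rank_identity_block {F : fieldType} {m n} (A : 'M[F]_(m, n)) :
  exists X Y, X *m A *m Y = 1%:M :> 'M_(\rank A).
Proof.
have /row_fullP[X XE] := col_base_full A.
have /row_freeP[Y YE] := row_base_free A.
by exists X, Y; rewrite -[X in _ *m X *m _]mulmx_base mulmxA XE mul1mx YE.
Qed.

Lemma left_kernel_ne0 {F : fieldType} {k r} (A : 'M[F]_(k, r)) :
  (r < k)%N -> exists2 v : 'rV_k, v != 0 & v *m A = 0.
Proof.
move=> rk; have: kermx A != 0.
  rewrite kermx_eq0 /row_free neq_ltn; apply/orP; left.
  exact: leq_ltn_trans (rank_leq_col A) rk.
by case/rowV0Pn => v /sub_kermxP vA v0; exists v.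
Qed.

Lemma exists_max_support {V : nmodType} {s} {v : 'rV[V]_s} (f : 'I_s -> nat) : v != 0 ->
  exists2 i0, v 0 i0 != 0 & forall i, v 0 i != 0 -> (f i <= f i0)%N.
Proof.
case/rV0Pn => i1 vi1; case: (@arg_maxnP _ i1 (fun i => v 0 i != 0) f vi1) => i0 vi0 max.
by exists i0.
Qed.

(** Only the product of the two top coefficients survives in the convolution; the size bounds need
    not be attained, so both sides may vanish. *)
Lemma coef_polyM_max {A : nzRingType} (p q : {poly A}) a b :
  (size p <= a.+1)%N -> (size q <= b.+1)%N -> (p * q)`_(a + b) = p`_a * q`_b.
Proof.
move=> sp sq; rewrite coefM (bigD1 (Ordinal (leq_addr b a : (a < (a + b).+1)%N))) //=.
rewrite addKn big1 ?addr0 // => i; rewrite -val_eqE /= neq_ltn => /orP[ia|ai].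
  by rewrite [q`__]nth_default ?mulr0 // (leq_trans sq) // ltn_subRL ltn_add2r.
by rewrite nth_default ?mul0r // (leq_trans sp).
Qed.

Lemma size_mulmx_leq {S : nzRingType} {m n p} (A : 'M[{poly S}]_(m, n)) (B : 'M_(n, p)) N i k :
  (forall j, (size (A i j * B j k)%R <= N)%N) -> (size ((A *m B) i k) <= N)%N.
Proof.
move=> ABN; rewrite mxE; apply: leq_trans (size_sum _ _ _) _.
exact/bigmax_leqP.
Qed.

Section BoundedRank.
Variable C : numClosedFieldType.

(** * Closedness: rank certificates, norms and evaluation at a point *)

Local Notation evalmx a := (map_mx (horner_eval (a : C))).

(** Clearing denominators turns the rank certificate over the field of fractions into a polynomial
    one, which can be evaluated at any point. *)
Lemma poly_identity_block {m n} (P : 'M[{poly C}]_(m, n)) :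
  exists q (X : 'M[{poly C}]_(normal_rank P, m)) Y,
    q != 0 /\ X *m P *m Y = q%:M.
Proof.
have [X0 [Y0 XPY]] := rank_identity_block (tofracmx P).
have [q1 [X [q1_0 XE]]] := common_denominator X0.
have [q2 [Y [q2_0 YE]]] := common_denominator Y0.
exists (q1 * q2), X, Y; split; first by rewrite mulf_neq0.
apply: tofracmx_inj; rewrite !map_mxM -XE -YE map_scalar_mx rmorphM /=.
rewrite -scalemxAr -!scalemxAl XPY scalerA scale_scalar_mx mulr1.
by rewrite mulrC.
Qed.

(** Chosen because it is submultiplicative and involves no square roots. *)
Definition l1norm {m n} (A : 'M[C]_(m, n)) : C := \sum_i \sum_j `|A i j|.

Lemma l1norm_ge0 {m n} (A : 'M[C]_(m, n)) : 0 <= l1norm A.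
Proof. by do 2![apply: sumr_ge0 => ? _]. Qed.

Lemma l1norm_gt0 {m n} (A : 'M[C]_(m, n)) : A != 0 -> 0 < l1norm A.
Proof.
move=> A0; rewrite lt_def l1norm_ge0 andbT; apply: contraNneq A0 => /eqP.
rewrite psumr_eq0 => [/allP Ai0 | i _]; last exact: sumr_ge0.
apply/eqP/matrixP => i j; have := Ai0 i (mem_index_enum _).
rewrite psumr_eq0 // => /allP/(_ j (mem_index_enum _)).
by rewrite normr_eq0 mxE => /eqP.
Qed.

Lemma l1normZ {m n} a (A : 'M[C]_(m, n)) : l1norm (a *: A) = `|a| * l1norm A.
Proof.
rewrite /l1norm mulr_sumr; apply: eq_bigr => i _; rewrite mulr_sumr.
by apply: eq_bigr => j _; rewrite mxE normrM.
Qed.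

Lemma l1norm_mulmx {m n p} (A : 'M[C]_(m, n)) (B : 'M[C]_(n, p)) :
  l1norm (A *m B) <= l1norm A * l1norm B.
Proof.
rewrite /l1norm mulr_suml; apply: ler_sum => i _.
rewrite mulr_suml.
apply: (@le_trans _ _ (\sum_j \sum_k `|A i k| * `|B k j|)).
  apply: ler_sum => j _; rewrite mxE; apply: (le_trans (ler_norm_sum _ _ _)).
  by apply: ler_sum => k _; rewrite normrM.
rewrite exchange_big; apply: ler_sum => k _; rewrite -mulr_sumr.
apply: ler_wpM2l => //.
by rewrite [leRHS](bigD1 k) //= lerDl !sumr_ge0 // => ? _; rewrite sumr_ge0.
Qed.

Lemma pdist_ge0 d {m n} (P Q : 'M[{poly C}]_(m, n)) : 0 <= pdist d P Q.
Proof.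
rewrite sqrtC_ge0; do 3![apply: sumr_ge0 => ? _].
exact: exprn_ge0.
Qed.

Lemma coef_le_pdist d {m n} (P Q : 'M[{poly C}]_(m, n)) (k : 'I_d.+1) i j :
  `|(P i j)`_k - (Q i j)`_k| <= pdist d P Q.
Proof.
rewrite -[leLHS]sqrCK // ler_sqrtC ?nnegrE ?exprn_ge0 //; last first.
  by do 3![apply: sumr_ge0 => ? _]; rewrite exprn_ge0.
rewrite (bigD1 k) //= (bigD1 i) //= (bigD1 j) //= -!addrA lerDl.
do 2?[apply: addr_ge0]; do 3?[apply: sumr_ge0 => ? _]; exact: exprn_ge0.
Qed.

(** Each coefficient of [P - Q] is bounded by the distance; expanding in powers of [a] leaves a
    factor independent of [P] and [Q]. *)
Lemma evalmx_le_pdist d {m n} (P Q : 'M[{poly C}]_(m, n)) a :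
  mxdeg_le d P -> mxdeg_le d Q ->
  l1norm (evalmx a (P - Q)) <=
    pdist d P Q * (\sum_(i < m) \sum_(j < n) \sum_(k < d.+1) `|a| ^+ k).
Proof.
move=> Pd Qd; rewrite mulr_sumr; apply: ler_sum => i _.
rewrite mulr_sumr; apply: ler_sum => j _; rewrite mulr_sumr !mxE /horner_eval.
have sz : (size (P i j - Q i j)%R <= d.+1)%N.
  by apply: leq_trans (size_polyD _ _) _; rewrite size_polyN geq_max Pd Qd.
rewrite (horner_coef_wide _ sz); apply: (le_trans (ler_norm_sum _ _ _)).
apply: ler_sum => k _; rewrite normrM normrX coefB ler_wpM2r ?exprn_ge0 //.
exact: coef_le_pdist.
Qed.

(* At a point [a] where [X P Y] is a nonzero multiple [q(a)] of the identity, a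
   left null vector [v] of [X(a) L(a)] satisfies [q(a) v = v X(a) (P - L R)(a) Y(a)],
   so [L R] cannot come arbitrarily close to [P]. *)
Lemma normal_rank_closed {m n} r d (P : 'M[{poly C}]_(m, n)) :
  closure_d d (setA r d) P -> (normal_rank P <= r)%N.
Proof.
case=> Pd Pcl; rewrite leqNgt; apply/negP => rk.
have [q [X [Y [q0 XPY]]]] := poly_identity_block P.
have [a qa] := closed_nonrootP q q0.
set S := \sum_(i < m) \sum_(j < n) \sum_(k < d.+1) `|a| ^+ k.
have S0 : 0 <= S by do 3![apply: sumr_ge0 => ? _]; rewrite exprn_ge0.
set K := l1norm (evalmx a X) * S * l1norm (evalmx a Y).
have K0 : 0 <= K by rewrite !mulr_ge0 ?l1norm_ge0.
have qa0 : 0 < `|q.[a]| by rewrite normr_gt0.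
(* With [1 + K] the radius makes sense even if [K = 0], and [pdist d P Q * K] stays strictly below
   [|q(a)|]. *)
have [Q [[L [R [QE _]]] [Qd PQ]]] := Pcl (`|q.[a]| / (1 + K)) (divr_gt0 qa0 (ltr_wpDr K0 ltr01)).
have [v v0 vL] := left_kernel_ne0 (evalmx a (X *m L)) rk.
have E : q.[a] *: v = v *m evalmx a X *m evalmx a (P - Q) *m evalmx a Y.
  rewrite -!mulmxA -!map_mxM /= mulmxBl mulmxBr QE !mulmxA XPY.
  rewrite map_mxB -(mulmxA _ R Y) map_mxM mulmxBr (mulmxA v) vL mul0mx subr0.
  by rewrite map_scalar_mx mul_mx_scalar.
have : `|q.[a]| * l1norm v <= l1norm v * (pdist d P Q * K).
  rewrite -l1normZ E; apply: (le_trans (l1norm_mulmx _ _)).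
  have -> : l1norm v * (pdist d P Q * K) =
    l1norm v * l1norm (evalmx a X) * (pdist d P Q * S) * l1norm (evalmx a Y).
    by rewrite /K !mulrA; congr (_ * _ * _); rewrite mulrAC.
  apply: ler_wpM2r; first exact: l1norm_ge0.
  apply: (le_trans (l1norm_mulmx _ _)).
  apply: ler_pM; rewrite ?l1norm_ge0 ?l1norm_mulmx //; exact: evalmx_le_pdist.
rewrite mulrC ler_pM2l ?l1norm_gt0 // => qK.
rewrite ltr_pdivlMr ?ltr_wpDr // in PQ.
have: pdist d P Q * K < pdist d P Q * K.
  apply: lt_le_trans qK; apply: le_lt_trans PQ; rewrite mulrDr mulr1 lerDr; exact: pdist_ge0.
by rewrite ltxx.
Qed.

(** * Minimal polynomial bases of the row space *)

(* One more than the degree, and [0] for the zero vector. *)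
Definition vsize {n} (w : 'rV[{poly C}]_n) : nat := \max_j size (w 0%R j).

Lemma leq_vsize {n} (w : 'rV[{poly C}]_n) j : (size (w 0%R j) <= vsize w)%N.
Proof. exact: (leq_bigmax j). Qed.

Lemma vsize_leq {n} (w : 'rV[{poly C}]_n) N :
  (forall j, size (w 0%R j) <= N)%N -> (vsize w <= N)%N.
Proof. by move=> wN; apply/bigmax_leqP. Qed.

(** As [B] has exactly [normal_rank P] rows, containing the row space of [P] already makes them a
    basis of it over the field of fractions. *)
Definition spanning_basis {m n} (P : 'M[{poly C}]_(m, n))
    (B : 'M[{poly C}]_(normal_rank P, n)) : bool :=
  (tofracmx P <= tofracmx B)%MS.

(** Forney's minimal bases: on nonzero rows [vsize] exceeds the degree by one, so minimizing its sum
    minimizes the total degree. *)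
Definition minimal_basis {m n} (P : 'M[{poly C}]_(m, n))
    (B : 'M[{poly C}]_(normal_rank P, n)) : Prop :=
  spanning_basis P B /\
  forall B', spanning_basis P B' ->
    (\sum_i vsize (row i B) <= \sum_i vsize (row i B'))%N.

Lemma spanning_basis_free {m n} {P : 'M[{poly C}]_(m, n)} {B} :
  spanning_basis P B -> row_free (tofracmx B).
Proof. by move/mxrankS=> PB; rewrite /row_free eqn_leq rank_leq_row. Qed.

Lemma minimal_basis_exists {m n} (P : 'M[{poly C}]_(m, n)) :
  exists B, minimal_basis P B.
Proof.
have [q [B0 [q0 B0E]]] := common_denominator (row_base (tofracmx P)).
have PB0 : spanning_basis P B0.
  rewrite /spanning_basis -B0E eqmx_scale ?tofrac_eq0 //.
  by rewrite eq_row_base.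
have exN : exists N, `[< exists2 B, spanning_basis P B & (\sum_i vsize (row i B))%N = N >].
  by exists (\sum_i vsize (row i B0))%N; apply/asboolP; exists B0.
case: (ex_minnP exN) => N /asboolP[B PB <-] minB; exists B; split=> // B' PB'.
by apply: minB; apply/asboolP; exists B'.
Qed.

(* [B_{i0}] is replaced by [w = (c B) / p]; it remains in the span as [c_{i0} <> 0]. *)
Lemma spanning_basis_exchange {m n} {P : 'M[{poly C}]_(m, n)} {B}
    {c : 'rV[{poly C}]_(normal_rank P)} {i0} {p : {poly C}} {w : 'rV_n} :
  spanning_basis P B -> p != 0 -> c 0 i0 != 0 -> p *: w = c *m B ->
  spanning_basis P (\matrix_i (if i == i0 then w else row i B)).
Proof.
set B' := \matrix_i _ => PB p0 c0 wE; apply: submx_trans PB _.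
have sub i : i != i0 -> (row i (tofracmx B) <= tofracmx B')%MS.
  move=> ii0; apply: (eq_row_sub i).
  by rewrite -!map_row rowK (negPf ii0).
apply/row_subP => i; have [-> {i}|/sub//] := eqVneq i i0.
have subw : (tofracmx w <= tofracmx B')%MS.
  by apply: (eq_row_sub i0); rewrite -map_row rowK eqxx.
(* Over the fractions it suffices to reach [c_{i0} B_{i0}], which is [p w] minus the other terms of
   [c B]. *)
rewrite -(eqmx_scale _ (_ : FracField.tofrac (c 0 i0) != 0)) ?tofrac_eq0 //.
have -> : FracField.tofrac (c 0 i0) *: row i0 (tofracmx B) =
    tofracmx (p *: w) - \sum_(i | i != i0) tofracmx c 0 i *: row i (tofracmx B).
  by rewrite wE map_mxM mulmx_sum_row (bigD1 i0) //= mxE addrK.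
rewrite addmx_sub ?eqmx_opp ?map_mxZ ?scalemx_sub //.
by apply: summx_sub => i ii0; rewrite scalemx_sub ?sub.
Qed.

(** The two bases differ in row [i0] only, so comparing totals compares just these rows. *)
Lemma minimal_basis_exchange {m n} {P : 'M[{poly C}]_(m, n)} {B}
    {c : 'rV[{poly C}]_(normal_rank P)} {i0} {p : {poly C}} {w : 'rV_n} :
  minimal_basis P B -> p != 0 -> c 0 i0 != 0 -> p *: w = c *m B ->
  (vsize (row i0 B) <= vsize w)%N.
Proof.
case=> PB minB p0 c0 wE.
have := minB _ (spanning_basis_exchange PB p0 c0 wE).
rewrite (bigD1 i0) //= [leqRHS](bigD1 i0) //= rowK eqxx.
under [X in (_ <= _ + X)%N -> _]eq_bigr => i /negPf ii0 do rewrite rowK ii0.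
by rewrite leq_add2r.
Qed.

(** A zero row would contradict independence; hence [(vsize _).-1] is the true degree of each
    row. *)
Lemma minimal_basis_vsize_gt0 {m n} {P : 'M[{poly C}]_(m, n)} {B} i :
  minimal_basis P B -> (0 < vsize (row i B))%N.
Proof.
case=> PB _; rewrite lt0n; apply/negP => /eqP Bi0.
have : row i (tofracmx B) = 0.
  rewrite -map_row; apply/rowP => j; rewrite mxE [RHS]mxE.
  have := leq_vsize (row i B) j; rewrite Bi0 leqn0 size_poly_eq0 => /eqP ->.
  exact: rmorph0.
move/eqP; rewrite rowE mulmx_free_eq0 ?(spanning_basis_free PB) //.
by move/eqP/rowP/(_ i)/eqP; rewrite !mxE !eqxx oner_eq0.
Qed.

(* If [v B(a) = 0] with [v] constant, [v B] is divisible by [X - a], and the quotient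
   could replace a row of maximal degree among those [v] involves. *)
Lemma minimal_basis_eval_free {m n} {P : 'M[{poly C}]_(m, n)} {B} a :
  minimal_basis P B -> row_free (evalmx a B).
Proof.
move=> minB; rewrite -kermx_eq0; apply/negPn/negP => /rowV0Pn[v /sub_kermxP vB v0].
have [i0 vi0 maxi0] := exists_max_support (fun i => vsize (row i B)) v0.
have size_gt0 := minimal_basis_vsize_gt0 i0 minB.
set c := map_mx polyC v; set w := \row_j ((c *m B) 0 j %/ ('X - a%:P)).
have wE : ('X - a%:P) *: w = c *m B.
  apply/rowP => j; rewrite !mxE mulrC divpK // dvdp_XsubCl.
  move/rowP/(_ j): vB; rewrite !mxE /root horner_sum => vB.
  rewrite -[X in _ == X]vB; apply/eqP/eq_bigr => i _.
  by rewrite !mxE hornerM hornerC.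
have ci0 : c 0 i0 != 0 by rewrite mxE polyC_eq0.
have := minimal_basis_exchange minB (monic_neq0 (monicXsubC a)) ci0 wE.
(* Rows involved in [v] have size at most that of row [i0], and dividing by [X - a] lowers the size
   by one. *)
apply/negP; rewrite -ltnNge -(ltn_predK size_gt0) ltnS; apply: vsize_leq => j.
rewrite mxE size_divp ?polyXsubC_eq0 // size_XsubC subn1 -!subn1 leq_sub2r //.
apply: size_mulmx_leq => i; rewrite mxE mul_polyC.
have [->|/maxi0 ii0] := eqVneq (v 0 i) 0; first by rewrite scale0r size_poly0.
apply: leq_trans (size_scale_leq _ _) _; apply: leq_trans ii0.
by have := leq_vsize (row i B) j; rewrite mxE.
Qed.

(** Coefficients are taken at the degree of the whole row, so entries of lower degree contribute
    zero. *)
Definition lead_row_mx {s n} (B : 'M[{poly C}]_(s, n)) : 'M[C]_(s, n) :=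
  \matrix_(i, j) (B i j)`_(vsize (row i B)).-1.

(** If [v] annihilates the leading coefficients, shifting the rows by powers of [X] to a common
    degree makes their top terms cancel; the combination would replace a row by one of lower
    degree. *)
Lemma minimal_basis_lead_free {m n} {P : 'M[{poly C}]_(m, n)} {B} :
  minimal_basis P B -> row_free (lead_row_mx B).
Proof.
move=> minB; rewrite -kermx_eq0; apply/negPn/negP => /rowV0Pn[v /sub_kermxP vB v0].
pose e i := (vsize (row i B)).-1.
have [i0 vi0 maxi0] := exists_max_support e v0.
have size_gt0 i := minimal_basis_vsize_gt0 i minB.
(* Where [e i > e i0] the subtraction truncates, but there [v 0 i = 0]. *)
set c := \row_i (v 0 i *: 'X^(e i0 - e i)).
have wE : 1 *: (c *m B) = c *m B by rewrite scale1r.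
have ci0 : c 0 i0 != 0 by rewrite mxE subnn expr0 scale_poly_eq0 negb_or vi0 oner_neq0.
have := minimal_basis_exchange minB (oner_neq0 _) ci0 wE.
apply/negP; rewrite -ltnNge -(ltn_predK (size_gt0 i0)) ltnS; apply: vsize_leq => j.
apply/leq_sizeP => k; rewrite leq_eqVlt => /predU1P[<-|].
  move/rowP/(_ j): vB; rewrite !mxE coef_sum => vB.
  rewrite -[RHS]vB; apply: eq_bigr => i _.
  rewrite !mxE -scalerAl coefZ coefXnM -/(e i0) ltnNge leq_subr /=.
  have [->|/maxi0 ii0] := eqVneq (v 0 i) 0; first by rewrite !mul0r.
  by rewrite subKn.
move: k; apply/leq_sizeP; apply: size_mulmx_leq => i; rewrite mxE -scalerAl.
have [->|/maxi0 ii0] := eqVneq (v 0 i) 0; first by rewrite scale0r size_poly0.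
apply: leq_trans (size_scale_leq _ _) _; apply: leq_trans (size_polyMleq _ _) _.
rewrite size_polyXn addSn /=.
have := leq_vsize (row i B) j; rewrite mxE => sz.
have eS k : vsize (row k B) = (e k).+1 by rewrite /e prednK.
by rewrite eS -[in leqRHS](subnK ii0) -addnS leq_add2l -eS.
Qed.

(** Induction on the degree of a common denominator [q]: at a root [a], [L(a) B(a) = 0] forces
    [L(a) = 0], so [X - a] cancels from [q] and [L]. *)
Lemma minimal_basis_factor {m n} {P : 'M[{poly C}]_(m, n)} {B} :
  minimal_basis P B -> exists L, P = L *m B.
Proof.
move=> minB; have [X PX] := submxP minB.1.
have [q [L [q0 LE]]] := common_denominator X.
have qP : q *: P = L *m B.
  by apply: tofracmx_inj; rewrite map_mxM -LE map_mxZ PX scalemxAl.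
move: {X PX LE} q0 qP; have [N] := ubnP (size q).
elim: N q L => // N IHN q L; rewrite ltnS => sq q0 qP.
have [/size_poly1P[c c0 qc]|/closed_rootP[a qa]] := boolP (size q == 1%N).
  exists (c^-1%:P *: L).
  by rewrite -scalemxAl -qP scalerA qc -polyCM mulVf // scale1r.
have La : map_mx (horner_eval a) L = 0.
  apply/eqP; rewrite -(mulmx_free_eq0 _ (minimal_basis_eval_free a minB)) -map_mxM -qP.
  by apply/eqP/matrixP => i j; rewrite !mxE rmorphM /= horner_evalE (rootP qa) mul0r.
move: qa; rewrite -dvdp_XsubCl => /divpK qE.
have X0 : 'X - a%:P != 0 by rewrite polyXsubC_eq0.
pose L' := \matrix_(i, j) (L i j %/ ('X - a%:P)).
have LE : L = ('X - a%:P) *: L'.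
  apply/matrixP => i j; rewrite !mxE mulrC divpK // dvdp_XsubCl.
  by move/matrixP/(_ i j): La; rewrite !mxE => /eqP.
apply: (IHN (q %/ ('X - a%:P)) L').
- rewrite size_divp // size_XsubC (leq_trans _ sq) // subn1 ltn_predL.
  by rewrite size_poly_gt0.
- by apply: contraNneq q0 => q'0; rewrite -qE q'0 mul0r.
- have /matrixP XE : ('X - a%:P) *: ((q %/ ('X - a%:P)) *: P) = ('X - a%:P) *: (L' *m B).
    by rewrite scalerA mulrC qE qP {1}LE scalemxAl.
  apply/matrixP => i j; apply: (mulfI X0).
  by have := XE i j; rewrite [in LHS]mxE [in RHS]mxE.
Qed.

(* No cancellation of leading terms can occur in [L B], since the leading row
   coefficients of [B] are linearly independent. *)
Lemma predictable_degree {m s n} {L : 'M[{poly C}]_(m, s)} {B : 'M_(s, n)} {d} :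
  row_free (lead_row_mx B) -> (forall i, 0 < vsize (row i B))%N ->
  mxdeg_le d (L *m B) ->
  forall j i, L j i != 0 -> (size (L j i) + vsize (row i B) <= d.+2)%N.
Proof.
move=> freeB B0 degP j i1 Li1.
pose e i := (vsize (row i B)).-1.
have eS i : vsize (row i B) = (e i).+1 by rewrite /e prednK.
case: (@arg_maxnP _ i1 (fun i => L j i != 0) (fun i => size (L j i) + e i)%N Li1).
move=> i0 Li0 maxi0; set D := (size (L j i0) + e i0).-1.
have DS : (size (L j i0) + e i0 = D.+1)%N by rewrite prednK // addn_gt0 size_poly_gt0 Li0.
rewrite eS addnS ltnS; apply: leq_trans (maxi0 _ Li1) _.
rewrite DS ltnS leqNgt; apply/negP => dD.
(* [D] is the largest degree of a product [L_{ji} B_i]. Entry [i] is the leading coefficient of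
   [L j i] if its product reaches degree [D], and 0 otherwise; [c *m lead_row_mx B] is then the
   coefficient of [X^D] in row [j] of [L B], zero as [D > d]. *)
pose c : 'rV[C]_s := \row_i (if L j i == 0 then 0 else (L j i)`_(D - e i)).
have /eqP : c *m lead_row_mx B = 0.
  apply/rowP => k; rewrite [RHS]mxE.
  rewrite -[RHS](nth_default 0 (leq_trans (degP j k) dD)) !mxE coef_sum.
  apply: eq_bigr => i _; rewrite !mxE.
  have [->|Li] := eqVneq (L j i) 0; first by rewrite !mul0r coef0.
  have := maxi0 i Li; rewrite DS => sL.
  have eD : (e i <= D)%N.
    by rewrite -ltnS (leq_trans _ sL) // -add1n leq_add2r size_poly_gt0.
  rewrite -[in RHS](subnK eD) coef_polyM_max //.
    by rewrite -subSn // leq_subRL ?(leqW eD) // addnC.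
  by have := leq_vsize (row i B) k; rewrite mxE eS.
rewrite mulmx_free_eq0 // => /eqP/rowP/(_ i0); rewrite !mxE (negPf Li0) => /eqP.
have -> : (D - e i0 = (size (L j i0)).-1)%N.
  by rewrite /D -subn1 subnAC addnK subn1.
by rewrite -lead_coefE lead_coef_eq0 (negPf Li0).
Qed.

(** * Degrees of vectors and a rank factorization with degree bounds *)

Lemma vdeg_eq {a b} (v : 'M[{poly C}]_(a, b)) k i j :
  (forall i j, size (v i j) <= k.+1)%N -> (v i j)`_k != 0 -> vdeg v = Some k.
Proof.
move=> sv vk; rewrite /vdeg; case: eqP => [v0|_].
  by rewrite v0 mxE coef0 eqxx in vk.
congr Some; apply/eqP; rewrite eqn_leq; apply/andP; split.
  by do 2![apply/bigmax_leqP => ? _]; rewrite -subn1 leq_subLR add1n.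
apply: leq_trans (leq_bigmax i); apply: leq_trans (leq_bigmax j).
rewrite -ltnS; apply: leq_trans (leqSpred _); rewrite ltnNge.
by apply: contra vk => sz; rewrite nth_default.
Qed.

Lemma vdeg_row_vsize {s n} (B : 'M[{poly C}]_(s, n)) i :
  (0 < vsize (row i B))%N -> vdeg (row i B) = Some (vsize (row i B)).-1.
Proof.
move=> B0; rewrite /vdeg; case: eqP => [Bi0|_].
  suff : (vsize (row i B) <= 0)%N by rewrite leqNgt B0.
  by apply: vsize_leq => j; rewrite Bi0 mxE size_poly0.
rewrite big_ord1; congr Some; apply/eqP; rewrite eqn_leq; apply/andP; split.
  by apply/bigmax_leqP => j _; rewrite -!subn1 leq_sub2r ?leq_vsize.
rewrite -subn1 leq_subLR add1n; apply: vsize_leq => j.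
by apply: leq_trans (leqSpred _) _; rewrite ltnS (leq_bigmax j).
Qed.

Lemma vsize_const1 {s n} (i : 'I_s) :
  (0 < n)%N -> vsize (row i (const_mx 1 : 'M[{poly C}]_(s, n))) = 1%N.
Proof.
move=> n0; apply/eqP; rewrite eqn_leq; apply/andP; split.
  by apply: vsize_leq => j; rewrite !mxE size_poly1.
by have := leq_vsize (row i (const_mx 1)) (Ordinal n0); rewrite !mxE size_poly1.
Qed.

(** Each size exceeds a degree by one, hence [d.+2]. The separate bound on rows of [R] covers zero
    columns of [L], where the sum alone would allow degree [d.+1]. *)
Lemma rank_factorization {m n r d} {P : 'M[{poly C}]_(m, n)} :
  (0 < n)%N -> mxdeg_le d P -> (normal_rank P <= r)%N ->
  exists (L : 'M[{poly C}]_(m, r)) (R : 'M[{poly C}]_(r, n)), P = L *m R /\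
    forall i, [/\ (0 < vsize (row i R))%N, (vsize (row i R) <= d.+1)%N
      & forall j, (size (L j i) + vsize (row i R) <= d.+2)%N].
Proof.
move=> n0 Pd rk; have [B minB] := minimal_basis_exists P.
have [L PE] := minimal_basis_factor minB.
have B0 i := minimal_basis_vsize_gt0 i minB.
have LBd : mxdeg_le d (L *m B) by rewrite -PE.
have degL := predictable_degree (minimal_basis_lead_free minB) B0 LBd.
rewrite -(subnKC rk); set t := (r - _)%N.
(* A row of [B] facing a zero column of [L] might have degree above [d]; it does not affect the
   product, so a constant row takes its place. *)
pose B1 := \matrix_i (if col i L == 0 then row i (const_mx 1) else row i B).
exists (row_mx L 0), (col_mx B1 (const_mx 1) : 'M_(_ + t, n)); split.
  rewrite mul_row_col mul0mx addr0 {1}PE; apply/matrixP => j k; rewrite !mxE.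
  apply: eq_bigr => i _; rewrite mxE; case: eqP => [/colP/(_ j)|_]; last by rewrite mxE.
  by rewrite !mxE => ->; rewrite !mul0r.
move=> i; case: (split_ordP i) => {i} i ->; last first.
  rewrite rowKd vsize_const1 //; split=> // j.
  by rewrite row_mxEr mxE size_poly0.
rewrite rowKu rowK; case: ifPn => [/eqP/colP Li0|].
  rewrite vsize_const1 //; split=> // j.
  by rewrite row_mxEl; have := Li0 j; rewrite !mxE => ->; rewrite size_poly0.
case/cV0Pn => j0; rewrite mxE => Lj0.
have Bd : (vsize (row i B) <= d.+1)%N.
  rewrite -ltnS; apply: leq_trans (degL _ _ Lj0).
  by rewrite -add1n leq_add2r size_poly_gt0.
split=> // j; rewrite row_mxEl.
have [->|] := eqVneq (L j i) 0; last exact: degL.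
by rewrite size_poly0 (leq_trans Bd).
Qed.

(** * Density by a small perturbation *)

Lemma pdist_addZ d {m n} (P M : 'M[{poly C}]_(m, n)) t :
  pdist d P (P + t%:P *: M) = `|t| * pdist d 0 M.
Proof.
rewrite /pdist -[`|t|]sqrCK // -rootCMl ?exprn_ge0 //; congr sqrtC.
do 3![rewrite mulr_sumr; apply: eq_bigr => ? _].
rewrite !mxE coefD coefCM opprD addNKr coef0 sub0r !normrN normrM.
by rewrite exprMn.
Qed.

Lemma setA_dense {m n} r d (P : 'M[{poly C}]_(m, n)) :
  (0 < m)%N -> (0 < n)%N -> mxdeg_le d P -> (normal_rank P <= r)%N ->
  closure_d d (setA r d) P.
Proof.
move=> m0 n0 Pd rk; split=> // eps eps0.
have [L [R [PE LR]]] := rank_factorization n0 Pd rk.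
pose b i := (vsize (row i R)).-1.
have bS i : vsize (row i R) = (b i).+1 by case: (LR i) => R0 _ _; rewrite /b prednK.
have bd i : (b i <= d)%N by case: (LR i); rewrite bS.
have Ld j i : (size (L j i) <= (d - b i).+1)%N.
  by case: (LR i) => _ _ /(_ j); rewrite bS -subSn // leq_subRL ?(leqW (bd i)) // addnS addnC.
pose j0 := Ordinal m0.
(* [N] touches exactly the columns of [L] that miss the degree [d - b i], so adding it cannot cancel
   an existing top coefficient. *)
pose N : 'M[{poly C}]_(m, r) := \matrix_(j, i)
  (if (j == j0) && [forall j', (L j' i)`_(d - b i) == 0] then 'X^(d - b i) else 0).
pose K := pdist d 0 (N *m R).
have K0 : 0 <= K by exact: pdist_ge0.
(* The perturbation moves [P] by [t * K], which is below [eps] since [K < 1 + K]. *)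
pose t := eps / (1 + K).
have t0 : 0 < t by rewrite divr_gt0 // ltr_wpDr.
pose Lt := L + t%:P *: N.
have Ltd j i : (size (Lt j i) <= (d - b i).+1)%N.
  rewrite !mxE mul_polyC; apply: leq_trans (size_polyD _ _) _.
  rewrite geq_max Ld (leq_trans (size_scale_leq _ _)) //.
  by case: ifP; rewrite ?size_polyXn ?size_poly0.
exists (Lt *m R); split; last split.
- exists Lt, R; split=> // i; rewrite vdeg_row_vsize ?bS //=.
  have [j Ltj] : exists j, (Lt j i)`_(d - b i) != 0.
    have [/forallP L0|] := boolP [forall j', (L j' i)`_(d - b i) == 0].
      exists j0; rewrite !mxE eqxx (introT forallP L0) coefD (eqP (L0 j0)) add0r.
      by rewrite coefCM coefXn eqxx mulr1 gt_eqF.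
    rewrite negb_forall => /existsP[j Lj]; exists j.
    rewrite !mxE ifF ?mulr0 ?addr0 //.
    by apply/negP => /andP[_ /forallP/(_ j)]; apply/negP.
  rewrite (vdeg_eq _ (d - b i) j 0) /=; first by rewrite subnK.
    by move=> k l; rewrite mxE.
  by rewrite mxE.
- move=> j k; apply: size_mulmx_leq => i; apply: leq_trans (size_polyMleq _ _) _.
  have := leq_vsize (row i R) k; rewrite mxE bS => Rd.
  rewrite -subn1 leq_subLR add1n -(subnK (bd i)) -addSn -addnS.
  exact: leq_add.
rewrite mulmxDl -PE -scalemxAl pdist_addZ gtr0_norm // -/K.
by rewrite mulrAC ltr_pdivrMr ?ltr_wpDr // ltr_pM2l // ltrDr ltr01.
Qed.

End BoundedRank.

Theorem theorem4p2 (R : realType) (m n r d : nat) :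
  (2 <= m)%N -> (2 <= n)%N -> (1 <= d)%N -> (0 < r)%N -> (r < minn m n)%N ->
  forall P : 'M[{poly R[i]}]_(m, n),
    (mxdeg_le d P /\ (normal_rank P <= r)%N) <-> closure_d d (@setA R[i] m n r d) P.
Proof.
move=> m2 n2 _ _ _ P; split=> [[Pd rk]|clP].
  by apply: setA_dense => //; apply: ltnW.
by split; [exact: clP.1 | exact: normal_rank_closed clP].
Qed.
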